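(* Let $k$ be a field of characteristic $p>0$ and $G$ a finite $p$-group. The invariant ring $D_k^G$ is a polynomial ring over $k$ of Krull-dimension $|G|-1$.
   Context: Let $V_{reg}=\bigoplus_{g\in G}kX_g$ be the regular right $kG$-module, with $(X_g)h=X_{gh}$ for $g,h\in G$. Define $D_k=D_k(G):=\mathrm{Sym}_k(V_{reg})/(\alpha)$ with $\alpha=-1+\sum_{g\in G}X_g$, with the induced (right) action of $G$ by $k$-algebra automorphisms. $D_k^G$ denotes the subring of $G$-fixed elements. *)

(* Defs.v *)
From HB Require Import structures.
From mathcomp Require Import all_boot all_order all_fingroup all_algebra all_solvable.
From mathcomp Require Import boolp generic_quotient mpoly.

Set Implicit Arguments.
Unset Strict Implicit.
Unset Printing Implicit Defensive.

Import GRing.Theory.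
Local Open Scope ring_scope.
Local Open Scope quotient_scope.

Section PrincipalIdeal.
Variables (R : comNzRingType) (a : R).

Definition principal_ideal : {pred R} := [pred x | `[< exists q : R, x = q * a >]].

Lemma principal_idealP x :
  reflect (exists q, x = q * a) (x \in principal_ideal).
Proof. exact: asboolP. Qed.

Lemma principal_idealr_closed :
  1 \notin principal_ideal -> idealr_closed principal_ideal.
Proof.
move=> n1; split=> //; first by apply/principal_idealP; exists 0; rewrite mul0r.
move=> b _ _ /principal_idealP[q ->] /principal_idealP[r ->].
by apply/principal_idealP; exists (b * q + r); rewrite mulrDl mulrA.
Qed.

End PrincipalIdeal.

Section RegularDehomogenization.
Variables (k : fieldType) (G : finGroupType).

(* Sym_k(V_reg) is the polynomial ring on the basis (X_g) of V_reg; mpoly numbers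
   its variables, so X_g is the variable of index enum_rank g. *)
Local Notation SymReg := {mpoly k[#|G|]}.

Definition X_ (g : G) : SymReg := 'X_(enum_rank g).

Definition symAct (h : G) (p : SymReg) : SymReg :=
  p \mPo [tuple X_ (enum_val i * h)%g | i < #|G|].

HB.instance Definition _ h := GRing.LRMorphism.copy (symAct h)
  (comp_mpoly [tuple X_ (enum_val i * h)%g | i < #|G|]).

Lemma symActX h g : symAct h (X_ g) = X_ (g * h)%g.
Proof. by rewrite /symAct comp_mpolyXU -tnth_nth tnth_mktuple enum_rankK. Qed.

Lemma symAct1 p : symAct 1%g p = p.
Proof.
rewrite /symAct -[RHS]comp_mpoly_id; congr (_ \mPo _).
by apply: eq_mktuple => i; rewrite mulg1 /X_ enum_valK.
Qed.

Lemma symActM h1 h2 p : symAct (h1 * h2)%g p = symAct h2 (symAct h1 p).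
Proof.
rewrite /symAct [LHS]comp_mpolyEX (comp_mpolyEX p) raddf_sum /=.
apply: eq_bigr => m _; rewrite !comp_mpolyX comp_mpolyZ rmorph_prod /=; congr (_ *: _).
apply: eq_bigr => i _; rewrite rmorphXn /= !tnth_mktuple.
by rewrite mulgA; congr (_ ^+ _); exact/esym/symActX.
Qed.

Definition alpha : SymReg := -1 + \sum_(g : G) X_ g.

Lemma symAct_alpha h : symAct h alpha = alpha.
Proof.
rewrite raddfD /= raddfN /= rmorph1 raddf_sum /=; congr (_ + _).
rewrite [RHS](reindex_inj (mulIg h)) /=.
by apply: eq_bigr => g _; rewrite symActX.
Qed.

Lemma alpha_proper : 1 \notin principal_ideal alpha.
Proof.
apply/principal_idealP => -[q /(congr1 (meval (fun i => (enum_val i == 1%g)%:R)))].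
rewrite rmorph1 rmorphM /= {1}/alpha raddfD /= raddfN /= rmorph1 raddf_sum /=.
rewrite (bigD1 1%g) //= mevalXU enum_rankK eqxx big1 => [|g /negPf g1].
  by rewrite addr0 addNr mulr0 => /eqP; rewrite oner_eq0.
by rewrite mevalXU enum_rankK g1.
Qed.

Definition alphaI : {pred SymReg} := principal_ideal alpha.

HB.instance Definition _ :=
  isIdealr.Build SymReg alphaI (principal_idealr_closed alpha_proper).

Definition Dk := {ideal_quot alphaI}.

HB.instance Definition _ := GRing.ComNzRing.on Dk.

Definition toDk : SymReg -> Dk := \pi_Dk.

HB.instance Definition _ := GRing.RMorphism.copy toDk \pi_Dk.

Lemma toDk_eq p q : (toDk p = toDk q) <-> exists r, p - q = r * alpha.
Proof.
have -> : (toDk p = toDk q) <-> p - q \in alphaI.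
  by rewrite Quotient.idealrBE; split=> [/eqP|/eqP].
by split=> /principal_idealP.
Qed.

Lemma toDk_repr x : toDk (repr x) = x.
Proof. exact: reprK. Qed.

Definition Dscale (c : k) (x : Dk) : Dk := toDk (c *: repr x).

Lemma toDkZ c p : toDk (c *: p) = Dscale c (toDk p).
Proof.
have [r e] := (toDk_eq p (repr (toDk p))).1 (esym (toDk_repr _)).
by apply/toDk_eq; exists (c *: r); rewrite -scalerBr e scalerAl.
Qed.

Lemma DscaleA c d x : Dscale c (Dscale d x) = Dscale (c * d) x.
Proof. by rewrite -[x]toDk_repr -!toDkZ scalerA. Qed.

Lemma Dscale1 : left_id 1 Dscale.
Proof. by move=> x; rewrite -[x]toDk_repr -toDkZ scale1r. Qed.

Lemma DscaleDr : right_distributive Dscale +%R.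
Proof.
by move=> c x y; rewrite -[x]toDk_repr -[y]toDk_repr -rmorphD -!toDkZ -rmorphD scalerDr.
Qed.

Lemma DscaleDl x : {morph Dscale^~ x : c d / c + d}.
Proof. by move=> c d /=; rewrite -[x]toDk_repr -!toDkZ -rmorphD scalerDl. Qed.

HB.instance Definition _ :=
  GRing.Zmodule_isLmodule.Build k Dk DscaleA Dscale1 DscaleDr DscaleDl.

Lemma toDk_scalable : scalable toDk.
Proof. exact: toDkZ. Qed.

HB.instance Definition _ :=
  GRing.isScalable.Build k SymReg Dk *:%R toDk toDk_scalable.

Lemma Dscale_mull c (x y : Dk) : c *: (x * y) = c *: x * y.
Proof.
rewrite -[x]toDk_repr -[y]toDk_repr -(rmorphM toDk) -!(linearZ_LR toDk).
by rewrite -(rmorphM toDk) scalerAl.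
Qed.

HB.instance Definition _ := GRing.Lmodule_isLalgebra.Build k Dk Dscale_mull.
HB.instance Definition _ := GRing.Lalgebra_isComAlgebra.Build k Dk.

Definition Dact (h : G) (x : Dk) : Dk := toDk (symAct h (repr x)).

Lemma Dact_toDk h p : Dact h (toDk p) = toDk (symAct h p).
Proof.
have [r e] := (toDk_eq (repr (toDk p)) p).1 (toDk_repr _).
apply/toDk_eq; exists (symAct h r).
by rewrite -raddfB e /= rmorphM /= symAct_alpha.
Qed.

Lemma Dact_zmod_morphism h : zmod_morphism (Dact h).
Proof.
move=> x y; rewrite -[x]toDk_repr -[y]toDk_repr.
by rewrite -rmorphB !Dact_toDk !raddfB.
Qed.

Lemma Dact_monoid_morphism h : monoid_morphism (Dact h).
Proof.
split; first by rewrite -(rmorph1 toDk) Dact_toDk !rmorph1.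
move=> x y; rewrite -[x]toDk_repr -[y]toDk_repr.
by rewrite -rmorphM !Dact_toDk !rmorphM.
Qed.

Lemma Dact_scalable h : scalable (Dact h).
Proof.
by move=> c x; rewrite -[x]toDk_repr -linearZ !Dact_toDk !linearZ.
Qed.

HB.instance Definition _ h :=
  GRing.isZmodMorphism.Build Dk Dk (Dact h) (Dact_zmod_morphism h).
HB.instance Definition _ h :=
  GRing.isMonoidMorphism.Build Dk Dk (Dact h) (Dact_monoid_morphism h).
HB.instance Definition _ h :=
  GRing.isScalable.Build k Dk Dk *:%R (Dact h) (Dact_scalable h).

Lemma Dact1 x : Dact 1%g x = x.
Proof. by rewrite -[x]toDk_repr Dact_toDk symAct1. Qed.

Lemma DactM h1 h2 x : Dact (h1 * h2)%g x = Dact h2 (Dact h1 x).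
Proof. by rewrite -[x]toDk_repr !Dact_toDk symActM. Qed.

Definition Dfixed : {pred Dk} := [pred x | [forall h, Dact h x == x]].

Lemma DfixedP x : reflect (forall h, Dact h x = x) (x \in Dfixed).
Proof. exact: 'forall_eqP. Qed.

Lemma Dfixed_subalg_closed : GRing.subalg_closed Dfixed.
Proof.
split=> [|c x y /DfixedP fx /DfixedP fy|x y /DfixedP fx /DfixedP fy];
  apply/DfixedP => h; first exact: rmorph1.
- by rewrite linearP /= fx fy.
- by rewrite rmorphM /= fx fy.
Qed.

HB.instance Definition _ :=
  GRing.isSubalgClosed.Build k Dk Dfixed Dfixed_subalg_closed.

Record DkG := MkDkG { DkG_val : Dk; _ : DkG_val \in Dfixed }.

HB.instance Definition _ := [isSub of DkG for DkG_val].
HB.instance Definition _ := [Choice of DkG by <:].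
HB.instance Definition _ := [SubChoice_isSubComNzRing of DkG by <:].
HB.instance Definition _ := [SubZmodule_isSubLmodule of DkG by <:].
HB.instance Definition _ := [SubNzRing_SubLmodule_isSubLalgebra of DkG by <:].
HB.instance Definition _ := [SubLalgebra_isSubAlgebra of DkG by <:].

End RegularDehomogenization.

Definition is_polynomial_ring (k : fieldType) (A : comAlgType k) : Prop :=
  exists (n : nat) (f : {lrmorphism {mpoly k[n]} -> A}), bijective f.

(* The length of a chain counts its n strict inclusions, not its n + 1 primes;
   a prime_idealr is by definition a proper ideal. *)
Definition prime_chain (R : comNzRingType) (n : nat)
    (P : 'I_n.+1 -> prime_idealr R) : Prop :=
  forall i j : 'I_n.+1, (i < j)%N ->
    {subset P i <= P j} /\ exists2 x, x \in P j & x \notin P i.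

Definition has_krull_dim (R : comNzRingType) (n : nat) : Prop :=
  (exists P : 'I_n.+1 -> prime_idealr R, prime_chain P) /\
  (forall m (P : 'I_m.+1 -> prime_idealr R), prime_chain P -> (m <= n)%N).

(* Main.v *)
Require Import Defs.
From HB Require Import structures.
From mathcomp Require Import all_boot all_order all_fingroup all_algebra all_solvable.
From mathcomp Require Import boolp generic_quotient mpoly.

(** The ring D = D_k(G) is the coordinate ring of the affine space of elements
    of kG of augmentation 1, on which the p-group G acts freely by right
    multiplication; the theorem says that the quotient is again an affine space.

    A function w : G -> k gives a linear form lin_form w = sum_g w(g) X_g, and
    the constant function 1 gives the unit of D.  Take a chain of normal
    subgroups G = N_0 > N_1 > ... > 1 with successive indices p.  The ring D is
    built up from k by adjoining linear forms one at a time, first those of the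
    N_1-invariant functions, then those of the N_2-invariant ones, and so on.
    Each new form t satisfies g t - t \in S for every g, where S is the subring
    reached so far, and S keeps two properties: some normal subgroup N acts
    trivially on it, and it has an element e with Tr(e) = 1, where Tr is the
    trace of G/N.  One new invariant f is produced at each step, of the form
    f = Tr(e u) = u + b with b in S:
    - if N fixes t, then u = t (invariants_adj_fixed);
    - if t is the form that opens the passage from N to a normal subgroup M of
      index p, then a generator c of N modulo M sends t to t + 1, and
      u = t^p - t (invariants_adj_shift).  The new trace-one element is
      e (1 - t^(p-1)) (has_trace_one_adj_shift).
    In both cases the invariants of S[t] are the invariants of S with f
    adjoined: an invariant x lies in S[f], and if x = sum_i b_i f^i then
    x = Tr(e x) = sum_i Tr(e b_i) f^i, whose coefficients are invariants of S.
    Moreover f is transcendental over S, being a monic polynomial in t.  After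
    the last step S = D, and D^G is a polynomial ring in as many variables as
    forms were adjoined.  Together with 1 these forms are a basis of the linear
    forms, so that there are |G| - 1 of them.

    Forms of the required kind exist for two reasons.  The quotient N/M is
    central in G/M, which gives a function on G that is shifted by the
    character of N/M along the cosets of N and whose translates differ from it
    by N-invariant functions (coset_character_function).  The other forms are
    vectors that the p-group G fixes modulo the forms already adjoined
    (exists_fixed_vector).

    For the Krull dimension, witnesses of the strict inclusions in a chain of
    primes are algebraically independent (chain_independent), and a ring of
    polynomials in n variables has no more than n such elements
    (mpoly_dependent).  The primes (X_1, ..., X_i) attain the bound. *)

Set Implicit Arguments.
Unset Strict Implicit.
Unset Printing Implicit Defensive.

Import GRing.Theory.
Local Open Scope ring_scope.

(** * Adjoining a transcendental element to a subring *)

Section Adjoin.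
Variable R : comNzRingType.
Implicit Types (S A : subringClosed R) (t x : R) (q : {poly R}).

Definition adj (S : {pred R}) (t : R) : {pred R} :=
  [pred x | `[< exists2 q : {poly R}, q \is a polyOver S & x = q.[t] >]].

Definition transc (S : {pred R}) (t : R) : Prop :=
  forall q : {poly R}, q \is a polyOver S -> q.[t] = 0 -> q = 0.

Lemma adjP (S : {pred R}) t x :
  reflect (exists2 q : {poly R}, q \is a polyOver S & x = q.[t]) (x \in adj S t).
Proof. exact: asboolP. Qed.

Lemma adj_base S t x : x \in S -> x \in adj S t.
Proof. by move=> Sx; apply/adjP; exists x%:P; rewrite ?hornerC // polyOverC. Qed.

Lemma adj_gen S t : t \in adj S t.
Proof. by apply/adjP; exists 'X; rewrite ?hornerX // polyOverX. Qed.

Lemma adj_subring_closed S t : GRing.subring_closed (adj S t).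
Proof.
split; first by apply: adj_base; apply: rpred1.
- move=> x y /adjP[q Sq ->] /adjP[r Sr ->]; apply/adjP.
  by exists (q - r); rewrite ?hornerD ?hornerN // rpredB.
- move=> x y /adjP[q Sq ->] /adjP[r Sr ->]; apply/adjP.
  by exists (q * r); rewrite ?hornerM // rpredM.
Qed.

HB.instance Definition _ S t :=
  GRing.isSubringClosed.Build R (adj S t) (adj_subring_closed S t).

Lemma adj_min A S t :
  {subset A <= S} -> t \in S -> {subset adj A t <= S}.
Proof.
move=> sub tS x /adjP[q Sq ->]; rewrite horner_coef rpred_sum // => i _.
by rewrite rpredM ?rpredX // sub // (polyOverP Sq).
Qed.

Lemma transc_sub A S t : {subset A <= S} -> transc S t -> transc A t.
Proof. by move=> sub tr q Sq; apply: tr; apply/polyOverP => i; apply/sub/(polyOverP Sq). Qed.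

(** Substitution of a monic non-constant polynomial multiplies degrees, over any
    commutative ring; the leading terms of the powers of g cannot cancel. *)
Lemma comp_poly_monic_eq0 (g q : {poly R}) :
  g \is monic -> (1 < size g)%N -> q \Po g = 0 -> q = 0.
Proof.
move=> mg sg; elim/poly_ind: q => [//|q c IH].
rewrite comp_polyD comp_polyM comp_polyX comp_polyC => E.
have [q0|qN0] := eqVneq (q \Po g) 0.
  by move: E; rewrite q0 mul0r add0r IH // mul0r add0r => /eqP; rewrite polyC_eq0 => /eqP->.
have : size ((q \Po g) * g) = size (- c%:P).
  by congr (size (_ : {poly R})); apply/eqP; rewrite -addr_eq0 E.
rewrite size_Mmonic // size_polyN => sz.
have := size_polyC_leq1 c; rewrite -sz.
have : (0 < size (q \Po g))%N by rewrite size_poly_gt0.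
by move: (size _) (size g) sg => a [|[|b]] // _ a0; rewrite addnS /= addnS; case: a a0.
Qed.

(** This is what makes t^p - t + b a free variable as soon as t is one. *)
Lemma transc_monic S t (g : {poly R}) :
  g \is a polyOver S -> g \is monic -> (1 < size g)%N -> transc S t ->
  transc S g.[t].
Proof.
move=> Sg mg sg tt q Sq; rewrite -horner_comp => /tt E.
by apply: (comp_poly_monic_eq0 mg sg); apply/E/polyOver_comp.
Qed.

End Adjoin.

(** * Power sums over the prime field *)

Section PowerSums.
Variables (R : comNzRingType) (p : nat).
Hypothesis pcharR : p \in [pchar R].
Implicit Types (t x : R).

Let p_pr : prime p := pcharf_prime pcharR.

Definition psum t l : R := \sum_(j < p) (t + j%:R) ^+ l.

(** Bezout's identity, reduced modulo p. *)
Lemma natr_unit_pchar n : (0 < n < p)%N -> exists y : R, y * n%:R = 1.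
Proof.
case/andP=> n0 np; have [a _ /dvdnP[b]] := Bezoutl n (prime_gt0 p_pr).
have /eqP-> : coprime p n by rewrite prime_coprime // gtnNdvd.
move=> /(congr1 (fun i => i%:R : R)) /=.
rewrite natrD !natrM (pcharf0 pcharR) mulr0 => /eqP; rewrite addr_eq0 => /eqP ba.
by exists (- a%:R); rewrite mulNr -ba.
Qed.

(** Telescoping (t + j + 1)^(l+1) - (t + j)^(l+1) over j expresses 0 as a
    combination of the power sums of degree at most l, in which the one of degree l
    has the invertible coefficient l + 1. *)
Lemma psum_small t l : (l < p.-1)%N -> psum t l = 0.
Proof.
elim/ltn_ind: l => l IH lp.
have lp1 : (l.+1 < p)%N by rewrite -ltn_predRL.
have : \sum_(j < p) ((t + j.+1%:R) ^+ l.+1 - (t + j%:R) ^+ l.+1) = 0.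
  rewrite -(big_mkord xpredT (fun j => (t + j.+1%:R) ^+ l.+1 - (t + j%:R) ^+ l.+1)).
  by rewrite telescope_sumr // (pcharf0 pcharR) subrr.
have -> : \sum_(j < p) ((t + j.+1%:R) ^+ l.+1 - (t + j%:R) ^+ l.+1)
   = \sum_(m < l.+1) psum t m *+ 'C(l.+1, m).
  rewrite /psum; under [RHS]eq_bigr do rewrite -sumrMnl.
  rewrite exchange_big /=; apply: eq_bigr => j _.
  rewrite -nat1r addrCA exprDn big_ord_recr /= binn subnn expr0 mul1r mulr1n addrK.
  by apply: eq_bigr => m _; rewrite expr1n mul1r.
rewrite big_ord_recr /= big1 => [|m _]; last by rewrite IH ?mul0rn // (ltn_trans _ lp).
rewrite add0r binSn => E.
have [|y yl] := @natr_unit_pchar l.+1; first by rewrite lp1.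
by rewrite -[LHS]mul1r -yl -mulrA mulr_natl E mulr0.
Qed.

(** Expanding in powers of t leaves only the sum of the j^(p-1), by the vanishing
    of the lower power sums; Fermat's little theorem evaluates it as p - 1. *)
Lemma psum_predp t : psum t p.-1 = -1.
Proof.
have E0 : psum 0 p.-1 = -1.
  have Ep n : (0 < n < p)%N -> n%:R ^+ p.-1 = 1 :> R.
    move=> np; have [y yn] := natr_unit_pchar np.
    rewrite -[LHS]mul1r -{1}yn -mulrA -exprS prednK ?prime_gt0 //.
    by rewrite -(pFrobenius_autE pcharR) pFrobenius_aut_nat.
  rewrite /psum; under eq_bigr do rewrite add0r.
  rewrite -(big_mkord xpredT (fun j => j%:R ^+ p.-1 : R)) big_ltn ?prime_gt0 //.
  rewrite expr0n -subn1 subn_eq0 leqNgt prime_gt1 //= add0r.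
  rewrite big_nat_cond (eq_bigr (fun=> 1)) => [|j]; last by rewrite andbT subn1; apply: Ep.
  by rewrite -big_nat_cond sumr_const_nat mulrnBr ?prime_gt0 // mulrn_pchar // sub0r.
rewrite {1}/psum; under eq_bigr do rewrite exprDn.
rewrite exchange_big big_ord_recr /= big1 => [|m _].
  rewrite add0r subnn binn -E0; apply: eq_bigr => j _.
  by rewrite expr0 mul1r mulr1n add0r.
transitivity (t ^+ (p.-1 - m) * psum 0 m *+ 'C(p.-1, m)).
  rewrite /psum mulr_sumr -sumrMnl; apply: eq_bigr => j _.
  by rewrite add0r.
by rewrite psum_small // mulr0 mul0rn.
Qed.

Definition artin_schreier t := t ^+ p - t.

Lemma artin_schreierD t x : artin_schreier (t + x) = artin_schreier t + artin_schreier x.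
Proof.
rewrite /artin_schreier -!(pFrobenius_autE pcharR) pFrobenius_autD_comm; last exact: mulrC.
by rewrite opprD addrACA.
Qed.

Lemma artin_schreier_nat n : artin_schreier n%:R = 0.
Proof. by rewrite /artin_schreier -(pFrobenius_autE pcharR) pFrobenius_aut_nat subrr. Qed.

(** Every t + j is a root of X^p - X - (t^p - t), so the power sums satisfy a
    linear recurrence with coefficients in the subring generated by t^p - t. *)
Lemma psum_adj (S : subringClosed R) t l : psum t l \in adj S (artin_schreier t).
Proof.
elim/ltn_ind: l => l IH.
have [lp|] := ltnP l p.
  move: lp; rewrite -(prednK (prime_gt0 p_pr)) ltnS leq_eqVlt => /orP[/eqP->|lp].
    by rewrite psum_predp rpredN1.
  by rewrite psum_small ?rpred0.
move=> pl; have E : psum t l = psum t (l - p).+1 + artin_schreier t * psum t (l - p).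
  rewrite /psum mulr_sumr -big_split /=; apply: eq_bigr => j _.
  rewrite -{1}(subnK pl) exprD exprS -mulrDl mulrC; congr (_ * _).
  by rewrite -[artin_schreier t]addr0 -(artin_schreier_nat j) -artin_schreierD /artin_schreier [RHS]addrC subrK.
rewrite E rpredD ?rpredM ?adj_gen ?IH //.
  by rewrite -subSn // ltn_subLR ?(leq_trans pl) // -[l.+1]add1n ltn_add2r prime_gt1.
by rewrite ltn_subrL prime_gt0 // (leq_trans _ pl) // prime_gt0.
Qed.

(** The Lagrange interpolation polynomial of the point 0 of the prime field:
    it takes the value 1 at 0 and 0 at every other j%:R. *)
Definition lagrange0 t : R := 1 - t ^+ p.-1.

Lemma sum_lagrange0 t : \sum_(j < p) lagrange0 (t + j%:R) = 1.
Proof.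
rewrite sumrB sumr_const card_ord (pcharf0 pcharR) sub0r.
by have := psum_predp t; rewrite /psum => ->; rewrite opprK.
Qed.

Lemma sum_lagrange0X (S : subringClosed R) t i :
  \sum_(j < p) lagrange0 (t + j%:R) * (t + j%:R) ^+ i \in adj S (artin_schreier t).
Proof.
under eq_bigr do rewrite mulrBl mul1r -exprD.
by rewrite sumrB rpredB // psum_adj.
Qed.

End PowerSums.

(** * Invariants of a ring with one more generator *)

Section Descent.
Variables (R : comNzRingType) (G : finGroupType) (act : G -> {rmorphism R -> R}).
Hypothesis act1 : forall x, act 1%g x = x.
Hypothesis actM : forall g h x, act (g * h)%g x = act h (act g x).
Implicit Types (S A : subringClosed R) (N M : {group G}) (t x : R).

Definition fixed_by (N : {set G}) x : Prop := forall g, g \in N -> act g x = x.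

Definition act_stable (S : {pred R}) : Prop := forall g x, x \in S -> act g x \in S.

(** The sequence T plays the part of a transversal of N in G: summing over it is
    the trace of G/N.  Only this consequence of being a transversal is recorded, as
    it passes to smaller subgroups without any choice of cosets. *)
Definition trace_to_invariants (N : {set G}) (T : seq G) : Prop :=
  forall x, fixed_by N x -> fixed_by [set: G] (\sum_(g <- T) act g x).

Definition has_trace_one (N : {set G}) (S : {pred R}) : Prop :=
  exists T e, [/\ trace_to_invariants N T, e \in S & \sum_(g <- T) act g e = 1].

Definition is_invariant_subring (A S : {pred R}) : Prop :=
  forall x, x \in A <-> x \in S /\ fixed_by [set: G] x.

Lemma fixed_sub_closed N x y : fixed_by N x -> fixed_by N y -> fixed_by N (x - y).
Proof. by move=> fx fy g Ng; rewrite rmorphB /= fx ?fy. Qed.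

Lemma fixed_mul N x y : fixed_by N x -> fixed_by N y -> fixed_by N (x * y).
Proof. by move=> fx fy g Ng; rewrite rmorphM /= fx ?fy. Qed.

Lemma fixed_exp N x n : fixed_by N x -> fixed_by N (x ^+ n).
Proof. by move=> fx g Ng; rewrite rmorphXn /= fx. Qed.

Lemma fixed_horner N (q : {poly R}) x :
  (forall i, fixed_by N q`_i) -> fixed_by N x -> fixed_by N q.[x].
Proof.
move=> fq fx g Ng; rewrite horner_coef rmorph_sum; apply: eq_bigr => i _ /=.
by rewrite rmorphM rmorphXn /= fq ?fx.
Qed.

Lemma fixed_adj N S t :
  {in S, forall x, fixed_by N x} -> fixed_by N t ->
  {in adj S t, forall x, fixed_by N x}.
Proof.
move=> fS ft x /adjP[q Sq ->]; apply: fixed_horner => // i.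
by apply/fS/(polyOverP Sq).
Qed.

(** The element Tr(e u) is invariant, and it differs from Tr(e) u = u by the sum
    of the (g e) (g u - u). *)
Lemma invariant_representative S N u :
  act_stable S -> {in S, forall x, fixed_by N x} -> has_trace_one N S ->
  fixed_by N u -> (forall g, act g u - u \in S) ->
  exists2 b, b \in S & fixed_by [set: G] (u + b).
Proof.
move=> stS fS [T [e [trT Se tre]]] fu uS.
exists (\sum_(g <- T) act g e * (act g u - u)).
  by rewrite rpred_sum // => g _; rewrite rpredM ?stS.
have -> : u + \sum_(g <- T) act g e * (act g u - u) = \sum_(g <- T) act g (e * u).
  rewrite -[X in X + _]mul1r -tre mulr_suml -big_split; apply: eq_bigr => g _ /=.
  by rewrite -mulrDr addrC subrK rmorphM.
by apply: trT; apply: fixed_mul => //; apply: fS.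
Qed.

(** If x = sum_i b_i f^i then x = Tr(e x) = sum_i Tr(e b_i) f^i. *)
Lemma invariants_adj S A N f x :
  act_stable S -> {in S, forall x, fixed_by N x} -> has_trace_one N S ->
  is_invariant_subring A S -> fixed_by [set: G] f ->
  x \in adj S f -> fixed_by [set: G] x -> x \in adj A f.
Proof.
move=> stS fS [T [e [trT Se tre]]] AS ff /adjP[q Sq xE] fx.
have {}xE : x = \sum_(i < size q) (\sum_(g <- T) act g (e * q`_i)) * f ^+ i.
  under eq_bigr do rewrite mulr_suml; rewrite exchange_big /=.
  rewrite -[LHS]mul1r -tre mulr_suml; apply: eq_bigr => g _.
  rewrite -{1}(fx g (in_setT _)) -rmorphM xE horner_coef mulr_sumr rmorph_sum.
  apply: eq_bigr => i _ /=.
  by rewrite mulrA rmorphM rmorphXn /= ff ?in_setT.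
rewrite xE rpred_sum // => i _; rewrite rpredM ?rpredX ?adj_gen //.
have Sqi := polyOverP Sq i.
apply: adj_base; apply/AS; split.
  by rewrite rpred_sum // => g _; rewrite stS // rpredM.
by apply: trT; apply: fixed_mul; apply: fS.
Qed.

(** The common part of the two kinds of steps: u = h(t) is a monic polynomial in
    the new element t, fixed by N, that accounts for all invariants. *)
Lemma invariants_adj_polynomial S A N t (h : {poly R}) :
  act_stable S -> {in S, forall x, fixed_by N x} -> has_trace_one N S ->
  is_invariant_subring A S -> transc S t ->
  h \is a polyOver S -> h \is monic -> (1 < size h)%N ->
  fixed_by N h.[t] -> (forall g, act g h.[t] - h.[t] \in S) ->
  (forall x, x \in adj S t -> fixed_by [set: G] x -> x \in adj S h.[t]) ->
  exists2 f, transc A f & is_invariant_subring (adj A f) (adj S t).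
Proof.
move=> stS fS trS AS tt Sh mh sh fu uS sub.
have [b Sb fb] := invariant_representative stS fS trS fu uS.
have subAS : {subset A <= S} by move=> x /AS[].
exists (h.[t] + b).
  apply: (transc_sub subAS); rewrite -[b](hornerC b t) -hornerD.
  have sb : (size b%:P < size h)%N by rewrite (leq_ltn_trans (size_polyC_leq1 b)).
  apply: transc_monic => //=; [by rewrite rpredD ?polyOverC | | ].
  - by rewrite monicE lead_coefDl // -monicE.
  - by rewrite size_polyDl.
move=> x; split=> [xA|[xS fx]]; last first.
  apply: (invariants_adj stS fS trS AS fb) => //.
  apply: (adj_min _ _ (sub x xS fx)) => [y|]; first exact: adj_base.
  by rewrite -[X in X \in _](addrK b) rpredB ?adj_gen ?adj_base.
split; last first.
  by apply: (@fixed_adj [set: G]%G A) xA => // y /AS[].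
apply: (adj_min _ _ xA) => [y /subAS|]; first exact: adj_base.
rewrite rpredD ?(adj_base _ Sb) // horner_coef rpred_sum // => i _.
rewrite rpredM ?rpredX ?adj_gen //.
by apply/adj_base/(polyOverP Sh).
Qed.

Lemma invariants_adj_fixed S A N t :
  act_stable S -> {in S, forall x, fixed_by N x} -> has_trace_one N S ->
  is_invariant_subring A S -> transc S t ->
  fixed_by N t -> (forall g, act g t - t \in S) ->
  exists2 f, transc A f & is_invariant_subring (adj A f) (adj S t).
Proof.
move=> stS fS trS AS tt ft tS.
apply: (@invariants_adj_polynomial _ _ N _ 'X);
  rewrite ?hornerX ?polyOverX ?monicX ?size_polyX //.
Qed.

Variable p : nat.
Hypothesis pcharR : p \in [pchar R].

Lemma act_expg_shift c t j : act c t = t + 1 -> act (c ^+ j)%g t = t + j%:R.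
Proof.
move=> ct; elim: j => [|j IH]; first by rewrite expg0 act1 addr0.
by rewrite expgSr actM IH rmorphD rmorph_nat /= ct -addrA nat1r.
Qed.

Lemma act_artin_schreier g x : act g (artin_schreier p x) = artin_schreier p (act g x).
Proof. by rewrite /artin_schreier rmorphB rmorphXn. Qed.

(** The translates of lagrange0 sum to 1.  Multiplying an invariant
    x = sum_i q_i t^i by this sum, and writing x as sum_i q_i (t + j)^i in the j-th
    term, turns each t^i into a sum over j that lies in S[t^p - t]. *)
Lemma fixed_adj_shift S c t x :
  {in S, forall y, act c y = y} -> act c t = t + 1 ->
  x \in adj S t -> act c x = x -> x \in adj S (artin_schreier p t).
Proof.
move=> fS ct /adjP[q Sq xE] fx.
(* x is fixed by c^j, which only moves t *)
have xj j : x = q.[t + j%:R].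
  have -> : x = act (c ^+ j)%g x.
    by elim: j => [|j IH]; rewrite ?expg0 ?act1 // expgSr actM -IH fx.
  rewrite xE !horner_coef rmorph_sum; apply: eq_bigr => i _ /=.
  rewrite rmorphM rmorphXn /= (act_expg_shift _ ct); congr (_ * _).
  elim: j => [|j IH]; rewrite ?expg0 ?act1 // expgSr actM IH fS //.
  exact: (polyOverP Sq).
have -> : x = \sum_(i < size q) q`_i * \sum_(j < p) lagrange0 p (t + j%:R) * (t + j%:R) ^+ i.
  transitivity ((\sum_(j < p) lagrange0 p (t + j%:R)) * x); first by rewrite sum_lagrange0 // mul1r.
  rewrite mulr_suml.
  under [RHS]eq_bigr do rewrite mulr_sumr; rewrite exchange_big /=.
  apply: eq_bigr => j _; rewrite {1}(xj j) horner_coef mulr_sumr.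
  by apply: eq_bigr => i _; rewrite mulrCA.
rewrite rpred_sum // => i _; rewrite rpredM ?sum_lagrange0X //.
by apply/adj_base/(polyOverP Sq).
Qed.

(** The trace of N/M sends e (1 - t^(p-1)) to e, because t runs through the t + j
    and the sum of the lagrange0 (t + j) is 1. *)
Lemma has_trace_one_adj_shift S N M c t :
  {in S, forall x, fixed_by N x} -> c \in N -> (c ^+ p)%g \in M ->
  c \in 'N(M)%g -> {in N, forall n, exists2 m, m \in M & exists i, n = (m * c ^+ i)%g} ->
  act c t = t + 1 -> has_trace_one N S -> has_trace_one M (adj S t).
Proof.
move=> fS Nc cpM nMc decN ct [T [e [trT Se tre]]].
exists [seq (c ^+ j * g)%g | g <- T, j <- iota 0 p], (e * lagrange0 p t).
have sumE x : \sum_(h <- [seq (c ^+ j * g)%g | g <- T, j <- iota 0 p]) act h x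
    = \sum_(g <- T) act g (\sum_(j < p) act (c ^+ j)%g x).
  rewrite big_allpairs_dep; apply: eq_bigr => g _ /=.
  rewrite rmorph_sum -(big_mkord xpredT (fun j => act g (act (c ^+ j)%g x))).
  by rewrite /index_iota subn0; apply: eq_bigr => j _; rewrite actM.
split; last first.
- rewrite sumE -tre; apply: eq_bigr => g _; congr (act g _).
  transitivity (e * \sum_(j < p) lagrange0 p (t + j%:R)); last by rewrite sum_lagrange0 // mulr1.
  rewrite mulr_sumr; apply: eq_bigr => j _.
  rewrite rmorphM (fS e) ?groupX //; congr (_ * _).
  by rewrite /lagrange0 rmorphB rmorph1 rmorphXn /= (act_expg_shift _ ct).
- by rewrite rpredM ?rpredB ?rpredX ?rpred1 ?adj_gen ?adj_base.
move=> x fx; rewrite sumE; apply: trT.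
(* the sum over the powers of c takes M-fixed elements to N-fixed ones *)
set y := \sum_(j < p) _.
have fyM m : m \in M -> act m y = y.
  move=> Mm; rewrite /y rmorph_sum; apply: eq_bigr => j _ /=.
  have nMcj : (c ^+ j)%g \in 'N(M)%g by rewrite groupX.
  rewrite -actM conjgCV actM fx // -mem_conjg.
  by rewrite (normP nMcj).
have fyc : act c y = y.
  rewrite /y rmorph_sum -(big_mkord xpredT (fun j => act c (act (c ^+ j)%g x))).
  rewrite -(big_mkord xpredT (fun j => act (c ^+ j)%g x)).
  have p0 : (0 < p)%N by rewrite prime_gt0 // (pcharf_prime pcharR).
  rewrite -[in LHS](prednK p0) -[in RHS](prednK p0) big_nat_recr //= [RHS]big_nat_recl //=.
  rewrite addrC expg0 act1 -actM -expgSr prednK // fx //; congr (_ + _).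
  by apply: eq_bigr => j _; rewrite expgSr actM.
move=> n /decN[m Mm [i ->]]; rewrite actM fyM //.
by elim: i => [|i IH]; rewrite ?expg0 ?act1 // expgSr actM IH.
Qed.

Lemma invariants_adj_shift S A N M c t :
  act_stable S -> {in S, forall x, fixed_by N x} -> has_trace_one N S ->
  is_invariant_subring A S -> transc S t ->
  c \in N -> {in N, forall n, exists2 m, m \in M & exists i, n = (m * c ^+ i)%g} ->
  fixed_by M t -> act c t = t + 1 -> (forall g, act g t - t \in S) ->
  exists2 f, transc A f & is_invariant_subring (adj A f) (adj S t).
Proof.
move=> stS fS trS AS tt Nc decN ft ct tS.
have p1 : (1 < p)%N by rewrite prime_gt1 // (pcharf_prime pcharR).
have sX : (size ('X : {poly R}) < size ('X^p : {poly R}))%N by rewrite size_polyX size_polyXn.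
have hE : ('X^p - 'X).[t] = artin_schreier p t by rewrite hornerD hornerN hornerXn hornerX.
have fs : act c (artin_schreier p t) = artin_schreier p t.
  by rewrite act_artin_schreier ct (artin_schreierD pcharR) (artin_schreier_nat pcharR 1) addr0.
apply: (@invariants_adj_polynomial _ _ N _ ('X^p - 'X)) => //; rewrite ?hE.
- by rewrite rpredB ?polyOverXn ?polyOverX.
- by rewrite monicE lead_coefDl ?size_polyN // -monicE monicXn.
- by rewrite size_polyDl ?size_polyN // size_polyXn ltnS ltnW.
- move=> n /decN[m Mm [i ->]]; rewrite actM.
  rewrite [act m _](_ : _ = artin_schreier p t); last by apply: fixed_sub_closed Mm => //; apply: fixed_exp.
  by elim: i => [|i IH]; rewrite ?expg0 ?act1 // expgSr actM IH.
- move=> g; have -> : act g (artin_schreier p t) - artin_schreier p t = artin_schreier p (act g t - t).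
    by apply/eqP; rewrite subr_eq -(artin_schreierD pcharR) subrK act_artin_schreier.
  by rewrite rpredB ?rpredX.
move=> x xS fx; apply: fixed_adj_shift xS (fx c (in_setT c)) => // y Sy.
exact: fS.
Qed.

End Descent.

(** * Towers of transcendental elements and polynomial rings *)

Section Towers.
Variables (k : fieldType) (R : comAlgType k).
Implicit Types (ts : seq R) (x t : R).

Definition scalars : {pred R} := [pred x | `[< exists c : k, x = c%:A >]].

Lemma scalarsP x : reflect (exists c : k, x = c%:A) (x \in scalars).
Proof. exact: asboolP. Qed.

Lemma scalars_subring_closed : GRing.subring_closed scalars.
Proof.
split; first by apply/scalarsP; exists 1; rewrite scale1r.
- by move=> _ _ /scalarsP[c ->] /scalarsP[d ->]; apply/scalarsP; exists (c - d); rewrite scalerBl.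
- move=> _ _ /scalarsP[c ->] /scalarsP[d ->]; apply/scalarsP; exists (c * d).
  by rewrite -scalerAl mul1r scalerA.
Qed.

HB.instance Definition _ :=
  GRing.isSubringClosed.Build R scalars scalars_subring_closed.

Fixpoint gen ts : subringClosed R :=
  if ts is t :: ts' then (adj (gen ts') t : subringClosed R)
  else (scalars : subringClosed R).

(** The entries are adjoined from the end of the list, each transcendental over
    the ring generated by the later ones.  This is algebraic independence over k, as
    tower_at_inj shows. *)
Fixpoint indep ts : Prop :=
  if ts is t :: ts' then transc (gen ts') t /\ indep ts' else True.

Lemma gen_scalar ts (c : k) : c%:A \in gen ts.
Proof. by elim: ts => [|t ts IH] /=; [apply/scalarsP; exists c | apply: adj_base]. Qed.

Lemma gen_scale ts (c : k) x : x \in gen ts -> c *: x \in gen ts.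
Proof. by move=> xts; rewrite -mulr_algl rpredM ?gen_scalar. Qed.

Lemma gen_mem ts t : t \in ts -> t \in gen ts.
Proof.
elim: ts => [//|u ts IH]; rewrite inE => /orP[/eqP-> | /IH tts] /=; first exact: adj_gen.
exact: adj_base.
Qed.

Definition mpoly_at (n : nat) (v : 'I_n -> R) : {mpoly k[n]} -> R :=
  mmap (GRing.in_alg R) v.

HB.instance Definition _ n v := GRing.RMorphism.copy (@mpoly_at n v) (mmap (GRing.in_alg R) v).

Lemma mpoly_at_scalable n v : scalable (@mpoly_at n v).
Proof. by move=> c q; rewrite /mpoly_at mmapZ /= mulr_algl. Qed.

HB.instance Definition _ n v :=
  GRing.isScalable.Build k {mpoly k[n]} R *:%R (@mpoly_at n v) (@mpoly_at_scalable n v).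

Lemma mpoly_atX n (v : 'I_n -> R) i : mpoly_at v 'X_i = v i.
Proof. by rewrite /mpoly_at mmapX mmap1U. Qed.

End Towers.

Section LastVariable.
Variables (k : fieldType) (R : comAlgType k) (n : nat).
Local Notation widen := (widen_ord (leqnSn n)).

Lemma mpoly_at_muni (v : 'I_n.+1 -> R) q :
  mpoly_at v q = (map_poly (mpoly_at (v \o widen)) (muni q)).[v ord_max].
Proof.
rewrite muniE raddf_sum horner_sum; apply: eq_bigr => m _ /=.
rewrite -mul_polyC rmorphM /= map_polyC map_polyXn hornerCM hornerXn /=.
rewrite linearZ /= /mpoly_at mmapX mulr_algl -scalerAl.
congr (_ *: _); rewrite /mmap1 big_ord_recr /=; congr (_ * _).
by apply: eq_bigr => i _; rewrite mnmE.
Qed.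

Lemma mpoly_at_widen (v : 'I_n.+1 -> R) q :
  mpoly_at v (mwiden q) = mpoly_at (v \o widen) q.
Proof.
rewrite raddf_sum; apply: eq_bigr => m _ /=.
rewrite rmorphM /= {1}/mpoly_at mmapC; congr (_ * _).
rewrite /mmap1 rmorph_prod; apply: eq_bigr => i _ /=.
by rewrite rmorphXn /= mpoly_atX.
Qed.

End LastVariable.

Lemma mpoly_at_id (k : fieldType) n (q : {mpoly k[n]}) : mpoly_at (fun i => 'X_i) q = q.
Proof.
rewrite [RHS]mpolyE /mpoly_at /mmap; apply: eq_bigr => m _.
by rewrite mulr_algl mmap1_id.
Qed.

Lemma mpoly0_const (k : fieldType) (q : {mpoly k[0]}) : q = (q@_0%MM)%:MP.
Proof.
apply/mpolyP => m; have -> : m = 0%MM by apply/mnmP => -[].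
by rewrite mcoeffC eqxx mulr1.
Qed.

Lemma muni_inj (k : fieldType) n : injective (@muni n k).
Proof.
apply: raddf_inj => q q0; rewrite -(mpoly_at_id q) mpoly_at_muni q0.
by rewrite rmorph0 horner0.
Qed.

Lemma mpoly_at_ext (k : fieldType) (R : comAlgType k) n (v w : 'I_n -> R) q :
  v =1 w -> mpoly_at v q = mpoly_at w q.
Proof. by move=> E; apply: eq_bigr => m _; congr (_ * _); apply: mmap1_eq. Qed.

Lemma mpoly_at_comp (k : fieldType) (R S : comAlgType k) (f : {lrmorphism R -> S})
  n (v : 'I_n -> R) q : f (mpoly_at v q) = mpoly_at (f \o v) q.
Proof.
rewrite rmorph_sum; apply: eq_bigr => m _ /=.
rewrite rmorphM /= linearZ rmorph1 /=; congr (_ * _).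
by rewrite rmorph_prod; apply: eq_bigr => i _; rewrite rmorphXn.
Qed.

Section TowerPolynomial.
Variables (k : fieldType) (R : comAlgType k).

(** The head of ts, adjoined last, is the value of the last variable. *)
Definition tower_at (ts : seq R) : {mpoly k[size ts]} -> R :=
  mpoly_at (fun i : 'I_(size ts) => (rev ts)`_i).

HB.instance Definition _ ts := GRing.LRMorphism.copy (@tower_at ts)
  (mpoly_at (fun i : 'I_(size ts) => (rev ts)`_i)).

Lemma tower_at_cons t ts q :
  @tower_at (t :: ts) q = (map_poly (@tower_at ts) (muni q)).[t].
Proof.
rewrite /tower_at mpoly_at_muni rev_cons nth_rcons size_rev /= ltnn eqxx.
congr (_.[_]); apply: eq_map_poly => r; apply: mpoly_at_ext => i /=.
by rewrite nth_rcons size_rev ltn_ord.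
Qed.

Lemma tower_at_widen t ts q : @tower_at (t :: ts) (mwiden q) = @tower_at ts q.
Proof.
rewrite /tower_at mpoly_at_widen; apply: mpoly_at_ext => i /=.
by rewrite rev_cons nth_rcons size_rev ltn_ord.
Qed.

Lemma tower_at_max t ts : @tower_at (t :: ts) 'X_ord_max = t.
Proof.
by rewrite /tower_at mpoly_atX rev_cons nth_rcons size_rev ltnn eqxx.
Qed.

Lemma tower_atP ts x : x \in gen ts <-> exists q, x = tower_at (ts := ts) q.
Proof.
elim: ts x => [|t ts IH] x /=.
  split=> [/scalarsP[c ->]|[q ->]].
    by exists c%:MP; rewrite /tower_at /mpoly_at mmapC.
  rewrite /tower_at /mpoly_at /mmap rpred_sum // => m _.
  rewrite rpredM ?(gen_scalar [::]) // /mmap1 big1 ?rpred1 // => i.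
  by case: i.
split=> [/adjP[r Sr ->]|[q ->]].
  rewrite horner_coef.
  have /choice[Q QE] : forall i, exists q, r`_i = tower_at (ts := ts) q.
    by move=> i; apply/IH/(polyOverP Sr).
  exists (\sum_(i < size r) mwiden (Q i) * 'X_ord_max ^+ i).
  rewrite rmorph_sum; apply: eq_bigr => i _ /=.
  by rewrite rmorphM rmorphXn /= tower_at_widen tower_at_max QE.
rewrite tower_at_cons; apply/adjP; exists (map_poly (@tower_at ts) (muni q)) => //.
apply/polyOverP => i; apply/IH; exists (muni q)`_i.
by rewrite coef_map.
Qed.

Lemma tower_at_inj ts : indep ts -> injective (@tower_at ts).
Proof.
elim: ts => [_|t ts IH [tr ind]]; apply: raddf_inj => q.
  rewrite (mpoly0_const q).
  rewrite /= /tower_at /mpoly_at mmapC /= => /eqP.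
  by rewrite scaler_eq0 oner_eq0 orbF => /eqP->.
rewrite /= tower_at_cons => q0.
apply: (@muni_inj _ _ q 0); rewrite rmorph0.
have /tr/(_ q0) : map_poly (@tower_at ts) (muni q) \is a polyOver (gen ts).
  by apply/polyOverP => i; rewrite coef_map; apply/tower_atP; exists (muni q)`_i.
move=> E; apply: (map_inj_poly (IH ind) (rmorph0 _)); rewrite E rmorph0 //.
Qed.

End TowerPolynomial.

(** * The Krull dimension of a polynomial ring *)

Section AlgebraicDependence.
Variable k : fieldType.

Lemma msizeM_leS n (p q : {mpoly k[n]}) d e :
  (msize p <= d.+1)%N -> (msize q <= e.+1)%N -> (msize (p * q) <= (d + e).+1)%N.
Proof.
have [->|p0] := eqVneq p 0; first by rewrite mul0r msize0.
have [->|q0] := eqVneq q 0; first by rewrite mulr0 msize0.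
move=> sp sq; rewrite msizeM // -subn1 leq_subLR.
by apply: leq_trans (leq_add sp sq) _; rewrite addSn addnS add1n.
Qed.

Lemma msize_mmap1 n m (v : 'I_m -> {mpoly k[n]}) d (a : 'I_m -> nat) :
  (forall i, msize (v i) <= d.+1)%N ->
  (msize (\prod_i v i ^+ a i) <= (\sum_i a i * d).+1)%N.
Proof.
move=> vd; elim/big_ind2: _ => [|p d1 q d2|i _]; first by rewrite msize1.
  exact: msizeM_leS.
elim: (a i) => [|j IH]; first by rewrite expr0 msize1.
by rewrite exprS mulSn msizeM_leS.
Qed.

Lemma wide_kernel (I J : finType) (F : I -> J -> k) :
  (#|J| < #|I|)%N -> exists2 u : I -> k, (exists i, u i != 0) & forall j, \sum_i u i * F i j = 0.
Proof.
move=> JI; pose M := \matrix_(i < #|I|, j < #|J|) F (enum_val i) (enum_val j).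
have : kermx M != 0.
  by rewrite -mxrank_eq0 mxrank_ker subn_eq0 -ltnNge (leq_ltn_trans (rank_leq_col M)).
case/rowV0Pn=> u /sub_kermxP uM u0.
exists (fun i => u 0 (enum_rank i)).
  have [i ui] : exists i, u 0 i != 0.
    apply/existsP; apply: contraR u0 => /existsPn u0; apply/eqP/rowP => i.
    by rewrite mxE; apply/eqP; have := u0 i; rewrite negbK.
  by exists (enum_val i); rewrite enum_valK.
move=> j; have := congr1 (fun A : 'rV_ _ => A 0 (enum_rank j)) uM.
rewrite !mxE => uMj; rewrite -[RHS]uMj (reindex _ (onW_bij _ (@enum_val_bij I))) /=.
by apply: eq_bigr => i _; rewrite mxE enum_valK enum_rankK.
Qed.

(** Count dimensions: the monomials in the v_i with exponents below N span a space
    of polynomials of degree below B = O(N), of dimension at most B^n, which is less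
    than N^m for large N. *)
Lemma mpoly_dependent n m (v : 'I_m -> {mpoly k[n]}) :
  (n < m)%N -> exists2 q : {mpoly k[m]}, q != 0 & mpoly_at v q = 0.
Proof.
move=> nm; pose d := \max_i msize (v i).
(* B bounds the size of a product of the v_i with exponents below N, and
   B^n = E^n N^n < N^(n+1) holds because N exceeds E^n. *)
have vd i : (msize (v i) <= d.+1)%N by rewrite ltnW // ltnS leq_bigmax.
pose E := (m * d).+1; pose N := (E ^ n).+1; pose B := (E * N)%N.
pose mon (b : {ffun 'I_m -> 'I_N}) : 'X_{1..m} := [multinom nat_of_ord (b i) | i < m].
pose col (b : {ffun 'I_n -> 'I_B}) : 'X_{1..n} := [multinom nat_of_ord (b i) | i < n].
pose F a := mmap1 v (mon a).
have card : (#|{ffun 'I_n -> 'I_B}| < #|{ffun 'I_m -> 'I_N}|)%N.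
  rewrite !card_ffun !card_ord /B expnMn.
  apply: (@leq_trans (N * N ^ n)); last by rewrite -expnS leq_pexp2l.
  by rewrite ltn_pmul2r ?expn_gt0.
have [u [a0 ua0] uF] := wide_kernel (fun a b => (F a)@_(col b)) card.
have mon_inj : injective mon.
  move=> a b /mnmP ab; apply/ffunP => i; apply: val_inj.
  by have := ab i; rewrite !mnmE.
exists (\sum_a u a *: 'X_[mon a]).
  apply: contraNneq ua0 => /(congr1 (mcoeff (mon a0))).
  rewrite raddf_sum (bigD1 a0) //= big1 => [|a aa0]; last first.
    by rewrite mcoeffZ mcoeffX (inj_eq mon_inj) (negPf aa0) mulr0.
  by rewrite mcoeffZ mcoeffX eqxx mulr1 addr0 mcoeff0 => /eqP.
have -> : mpoly_at v (\sum_a u a *: 'X_[mon a]) = \sum_a u a *: F a.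
  by rewrite raddf_sum; apply: eq_bigr => a _; rewrite /= linearZ /= /mpoly_at mmapX.
apply/mpolyP => b; rewrite mcoeff0.
have Fsmall a : (msize (F a) <= B)%N.
  apply: leq_trans (msize_mmap1 _ vd) _; rewrite /B mulSn -addn1 addnC.
  apply: leq_add; first by [].
  rewrite -mulnA -[X in (_ <= X * _)%N]card_ord -sum_nat_const leq_sum // => i _.
  by rewrite mulnC leq_mul // mnmE ltnW.
have [bB|/forallPn[i bi]] := boolP [forall i, (b i < B)%N].
  pose b' : {ffun 'I_n -> 'I_B} := [ffun i => Ordinal (forallP bB i)].
  rewrite -[RHS](uF b') raddf_sum; apply: eq_bigr => a _ /=; rewrite mcoeffZ.
  by congr (_ * (F a)@_ _); apply/mnmP => i; rewrite mnmE ffunE.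
rewrite raddf_sum big1 // => a _ /=; rewrite mcoeffZ.
apply/eqP; rewrite mulf_eq0 mcoeff_eq0 msize_mdeg_ge ?orbT //.
apply: leq_trans (Fsmall a) _; apply: (@leq_trans (b i)); first by rewrite leqNgt.
by rewrite mdegE (bigD1 i) //= leq_addr.
Qed.

End AlgebraicDependence.

Section KernelPrime.
Variables (A : comNzRingType) (B : idomainType) (g : {rmorphism A -> B}).

Definition ker_pred : {pred A} := [pred x | g x == 0].

Lemma ker_idealr_closed : idealr_closed ker_pred.
Proof.
split; rewrite ?inE ?rmorph0 ?rmorph1 ?oner_eq0 //.
by move=> a x y /eqP gx /eqP gy; rewrite inE rmorphD rmorphM /= gx gy mulr0 addr0.
Qed.

Lemma ker_prime_closed : prime_idealr_closed ker_pred.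
Proof. by move=> x y; rewrite !inE rmorphM mulf_eq0. Qed.

HB.instance Definition _ := isIdealr.Build A ker_pred ker_idealr_closed.
HB.instance Definition _ := isPrimeIdealrClosed.Build A ker_pred ker_prime_closed.

Definition ker_prime : prime_idealr A := ker_pred.

End KernelPrime.

Section KrullDimension.
Variables (k : fieldType) (A : comAlgType k).

(** Modulo I_n, the element v_(n-1) is neither zero nor a zero divisor, and modulo
    I_(n-1) it vanishes.  So a polynomial in it with value in I_n has its constant
    term in I_(n-1), hence zero by induction on n, and it can be divided by v_(n-1). *)
Lemma chain_independent n (I : nat -> prime_idealr A) (v : 'I_n -> A) :
  (forall i : 'I_n, [/\ {subset I i.+1 <= I i}, v i \in I i & v i \notin I i.+1]) ->
  forall q, mpoly_at v q \in I n -> q = 0.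
Proof.
elim: n v => [|n IH] v Iv q.
  rewrite (mpoly0_const q) /mpoly_at mmapC /= => c0.
  have [-> //|cN0] := eqVneq (q@_0%MM) 0.
  have := idealMr (q@_0%MM)^-1%:A c0; rewrite -scalerAl mul1r scalerA mulVf // scale1r.
  by rewrite idealr1.
rewrite mpoly_at_muni => qI; apply: (@muni_inj _ _ q 0); rewrite rmorph0.
have [sub vI vNI] := Iv ord_max; move: (muni q) qI sub vI vNI => /= r.
move=> + sub vI vNI; elim/poly_ind: r => [//|r c IHr].
rewrite rmorphD rmorphM /= map_polyX map_polyC hornerD hornerMX hornerC /= => rcI.
have c0 : c = 0.
  apply: (IH (v \o widen_ord (leqnSn n))) => [i|]; first exact: (Iv (widen_ord _ i)).
  by have := sub _ rcI; rewrite rpredDl // idealMr.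
move: rcI; rewrite c0 rmorph0 addr0 prime_idealrM (negPf vNI) orbF => /IHr->.
by rewrite mul0r addr0.
Qed.

Variables (n : nat) (f : {lrmorphism {mpoly k[n]} -> A}).

(** Its kernel is the prime generated by the first i variables. *)
Definition kill_vars (i : nat) : {mpoly k[n]} -> {mpoly k[n]} :=
  mpoly_at (fun j : 'I_n => if (j < i)%N then 0 else 'X_j).

HB.instance Definition _ i := GRing.LRMorphism.copy (kill_vars i)
  (mpoly_at (fun j : 'I_n => if (j < i)%N then 0 else 'X_j)).

Lemma kill_varsX i (j : 'I_n) : kill_vars i 'X_j = if (j < i)%N then 0 else 'X_j.
Proof. exact: mpoly_atX. Qed.

Lemma kill_vars_comp i j q : (i <= j)%N -> kill_vars j (kill_vars i q) = kill_vars j q.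
Proof.
move=> ij; rewrite {2}/kill_vars mpoly_at_comp; apply: mpoly_at_ext => l /=.
have [li|_] := ltnP l i; last exact: kill_varsX.
by rewrite rmorph0 (leq_trans li ij).
Qed.

Lemma krull_dim_mpoly : bijective f -> has_krull_dim A n.
Proof.
case=> g fK gK; split.
  have zg : zmod_morphism g by move=> x y; apply: (can_inj fK); rewrite rmorphB /= !gK.
  have mg : monoid_morphism g.
    by split=> [|x y]; apply: (can_inj fK); rewrite ?rmorph1 ?rmorphM /= !gK ?rmorph1.
  pose g1 : {additive A -> {mpoly k[n]}} := HB.pack g (GRing.isZmodMorphism.Build _ _ g zg).
  pose gr : {rmorphism A -> {mpoly k[n]}} := HB.pack g g1 (GRing.isMonoidMorphism.Build _ _ g mg).
  exists (fun i : 'I_n.+1 => ker_prime (kill_vars i \o gr)) => i j ij; split.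
    move=> x; rewrite !inE /= => /eqP gx.
    by rewrite -(kill_vars_comp _ (ltnW ij)) gx rmorph0.
  have iN : (i < n)%N by rewrite (leq_trans ij) // -ltnS.
  exists (f 'X_(Ordinal iN)); rewrite inE /= fK kill_varsX /= ?ij ?ltnn ?eqxx //.
  by rewrite -msize_poly_eq0 msizeX.
move=> m P chP; rewrite leqNgt; apply/negP => nm.
(* chain_independent wants the primes in decreasing order *)
pose I i := P (inord (m - i)).
have step (i : 'I_m) : {subset I i.+1 <= I i} /\ exists2 x, x \in I i & x \notin I i.+1.
  by apply: chP; rewrite !inordK ?ltnS ?leq_subr // ltn_sub2l.
have /choice[v vP] : forall i : 'I_m, exists x, x \in I i /\ x \notin I i.+1.
  by move=> i; have [_ [x]] := step i; exists x.
have [q q0 qv] := mpoly_dependent (g \o v) nm.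
case/eqP: q0; apply: (@chain_independent m I v) => [i|].
  by split; [apply: (step i).1 | apply: (vP i).1 | apply: (vP i).2].
have -> : mpoly_at v q = f (mpoly_at (g \o v) q).
  by rewrite mpoly_at_comp; apply: mpoly_at_ext => i /=; rewrite gK.
by rewrite qv rmorph0 rpred0.
Qed.

End KrullDimension.

(** * A step of a chief series of a p-group *)

Section ChiefStep.
Variables (k : fieldType) (p : nat) (G : finGroupType).
Hypotheses (charkp : p \in [pchar k]) (pG : (p.-group [set: G])%g).
Local Open Scope group_scope.

(** The function chi is the isomorphism of N/M with the prime field that sends c
    to 1.  It is invariant under conjugation because a normal subgroup of order p of
    a p-group is central. *)
Lemma chief_step (N : {group G}) :
  N <| [set: G] -> N :!=: 1 ->
  exists (M : {group G}) (c : G) (chi : G -> k),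
    [/\ M <| [set: G], M \proper N, c \in N & c ^+ p \in M] /\
    [/\ {in N, forall n, exists2 m, m \in M & exists i, n = m * c ^+ i},
        {in N &, forall x y, chi (x * y) = (chi x + chi y)%R},
        {in M, forall m, chi m = 0%R}, chi c = 1%R
      & {in N, forall n h, chi (n ^ h) = chi n}].
Proof.
move=> nN nt; have p_pr := pcharf_prime charkp.
have pN : p.-group N := pgroupS (subsetT N) pG.
have [_ p_dvd [r cardN]] := pgroup_pdiv pN nt.
have rN : (r <= logn p #|N|)%N by rewrite cardN pfactorK.
have [M [sMN nM cardM]] := normal_pgroup pG nN rN.
have nMG h : h \in 'N(M) by apply: (subsetP (normal_norm nM)); rewrite inE.
have oNM : #|N / M| = p.
  rewrite card_quotient ?(subset_trans (subsetT N) (normal_norm nM)) //.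
  by rewrite -divgS // cardN cardM expnS mulnK // expn_gt0 prime_gt0.
have pMN : M \proper N.
  by rewrite properEcard sMN cardN cardM ltn_exp2l ?prime_gt1 ?leqnn.
have [_ [c Nc Mc]] := properP pMN.
have genNM : N / M = <[coset M c]>.
  apply: nt_gen_prime; first by rewrite oNM.
  by rewrite !inE mem_quotient // andbT; apply: contraNneq Mc; apply: coset_idr.
have ordc : #[coset M c] = p by rewrite /order -genNM oNM.
have cos n : n \in N -> exists i, coset M n = coset M c ^+ i.
  by move=> Nn; apply/cycleP; rewrite -genNM mem_quotient.
pose chi n : k := if [pick i : 'I_p | coset M n == coset M c ^+ i] is Some i then (i%:R)%R else 0%R.
have chiE n i : coset M n = coset M c ^+ i -> chi n = (i%:R)%R.
  move=> ni; rewrite /chi; case: pickP => [j|/(_ (Ordinal (ltn_pmod i (prime_gt0 p_pr))))] /=.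
    rewrite ni eq_expg_mod_order ordc => /eqP ij.
    by rewrite -(GRing.natr_mod_pchar charkp j) -ij GRing.natr_mod_pchar.
  by rewrite ni -ordc expg_mod_order eqxx.
exists M, c, chi; split; first by split=> //; apply: coset_idr; rewrite ?morphX //= -ordc expg_order.
split=> [n Nn|x y Nx Ny|m Mm||n Nn h].
- have [i ni] := cos n Nn; exists (n * c ^- i); last by exists i; rewrite mulgKV.
  by apply: coset_idr; rewrite // morphM ?nMG //= ni morphV ?morphX ?nMG //= mulgV.
- have [[i xi] [j yj]] := (cos x Nx, cos y Ny).
  by rewrite (chiE x i) // (chiE y j) // -natrD; apply: chiE; rewrite morphM //= xi yj expgD.
- by apply: (chiE m 0%N); rewrite coset_id.
- by apply: (chiE c 1%N); rewrite expg1.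
have [i ni] := cos n Nn; rewrite (chiE n i) //; apply: chiE; rewrite -ni.
have nNM : N / M <| [set: G] / M by apply: quotient_normal.
have cent : N / M \subset 'Z([set: G] / M).
  apply: prime_meetG; first by rewrite oNM.
  apply: meet_center_nil => //; last by rewrite -cardG_gt1 oNM prime_gt1.
  exact: quotient_nil (pgroup_nil pG).
have /centerP[_ /(_ (coset M h))] := subsetP cent _ (mem_quotient M Nn).
rewrite morphJ //= => /(_ (mem_quotient _ (in_setT _))) cnh.
by rewrite conjgE cnh mulKg.
Qed.

(** On each left coset of N, the function l is chi counted from a representative.
    A right translation by h changes it by a function constant on these cosets,
    since conjugation by h does not affect chi. *)
Lemma coset_character_function (N : {group G}) (chi : G -> k) :
  N <| [set: G] ->
  {in N &, forall x y, chi (x * y) = (chi x + chi y)%R} ->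
  {in N, forall n h, chi (n ^ h) = chi n} ->
  exists l : G -> k,
    {in N, forall n g, l (g * n) = (l g + chi n)%R} /\
    {in N, forall n g h, (l (g * n * h)%g - l (g * n)%g = l (g * h)%g - l g)%R}.
Proof.
move=> nN chiM chiJ; pose r g := fingroup.repr (g *: N).
have rN g : (r g)^-1 * g \in N.
  have : r g \in g *: N by apply: (mem_repr g); rewrite lcoset_refl.
  by move/lcosetP=> [n Nn ->]; rewrite invMg mulgKV groupV.
have lN : {in N, forall n g, chi ((r (g * n))^-1 * (g * n)) = (chi ((r g)^-1 * g)%g + chi n)%R}.
  move=> n Nn g; rewrite /r lcosetM [n *: N](lcoset_id Nn) mulgA.
  by rewrite chiM // rN.
exists (fun g => chi ((r g)^-1 * g)); split=> // n Nn g h.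
have -> : g * n * h = g * h * n ^ h by rewrite conjgE !mulgA mulgK.
have Nnh : n ^ h \in N by rewrite memJ_norm // (subsetP (normal_norm nN)) ?inE.
by rewrite (lN _ Nnh) (lN _ Nn) chiJ // opprD addrACA subrr addr0.
Qed.

End ChiefStep.

(** * Linear forms and the descent along a chief series *)

(** A polynomial q over S with q(t) = 0 is recovered as theta (q(t)). *)
Lemma transc_of_hom (R : comNzRingType) (S : subringClosed R) (t : R)
    (theta : {rmorphism R -> {poly R}}) :
  {in S, forall x, theta x = x%:P} -> theta t = 'X -> transc S t.
Proof.
move=> thS tht q Sq /(congr1 theta); rewrite rmorph0 => <-.
rewrite horner_coef rmorph_sum -[LHS]coefK poly_def; apply: eq_bigr => i _ /=.
by rewrite rmorphM rmorphXn /= tht thS ?(polyOverP Sq) // mul_polyC.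
Qed.

Lemma polyC_scaleDl (k : fieldType) (A : comAlgType k) (c d : k) (x : A) (u : {poly A}) :
  c%:A%:P * (x%:P + d%:A%:P * u) = (c *: x)%:P + (c * d)%:A%:P * u.
Proof. by rewrite mulrDr mulrA -!polyCM !mulr_algl scalerA. Qed.

Section LinearForms.
Variables (k : fieldType) (G : finGroupType) (D : comAlgType k).
Variables (xi : G -> D) (act : G -> {rmorphism D -> D}).
Local Notation Fun := {ffun G -> k^o}.

Hypothesis sum_xi : \sum_g xi g = 1.
Hypothesis act1 : forall x, act 1%g x = x.
Hypothesis actM : forall g h x, act (g * h)%g x = act h (act g x).
Hypothesis act_scalar : forall h (c : k), act h c%:A = c%:A.
Hypothesis act_xi : forall g h, act h (xi g) = xi (g * h)%g.
Hypothesis xi_gen : forall S : subringClosed D,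
  (forall c : k, c%:A \in S) -> (forall g, xi g \in S) -> forall x, x \in S.
Hypothesis xi_universal : forall (B : comNzRingType) (f : {rmorphism k -> B}) (a : G -> B),
  \sum_g a g = 1 ->
  exists theta : {rmorphism D -> B},
    (forall g, theta (xi g) = a g) /\ (forall c : k, theta c%:A = f c).

Definition translate (h : G) (w : Fun) : Fun := [ffun g => w (g * h^-1)%g].

Lemma translate_linear h : linear (translate h).
Proof. by move=> c v w; apply/ffunP => g; rewrite !ffunE. Qed.

HB.instance Definition _ h := GRing.isLinear.Build k Fun Fun *:%R (translate h) (translate_linear h).

Lemma translate1 w : translate 1 w = w.
Proof. by apply/ffunP => g; rewrite ffunE invg1 mulg1. Qed.

Lemma translateM g h w : translate (g * h) w = translate h (translate g w).
Proof. by apply/ffunP => x; rewrite !ffunE invMg mulgA. Qed.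

Definition lin_form (w : Fun) : D := \sum_g (w g : k) *: xi g.

Lemma lin_form_linear : linear lin_form.
Proof.
move=> c v w; rewrite /lin_form scaler_sumr -big_split; apply: eq_bigr => g _ /=.
by rewrite !ffunE scalerDl scalerA.
Qed.

HB.instance Definition _ := GRing.isLinear.Build k Fun D *:%R lin_form lin_form_linear.

Definition one_fun : Fun := [ffun=> 1].

Lemma lin_form_one : lin_form one_fun = 1.
Proof. by rewrite -sum_xi; apply: eq_bigr => g _; rewrite ffunE scale1r. Qed.

Lemma translate_one h : translate h one_fun = one_fun.
Proof. by apply/ffunP => g; rewrite !ffunE. Qed.

Lemma act_lin_form h w : act h (lin_form w) = lin_form (translate h w).
Proof.
rewrite /lin_form rmorph_sum [RHS](reindex_inj (mulIg h)) /=; apply: eq_bigr => g _.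
by rewrite -mulr_algl rmorphM act_scalar act_xi ffunE mulgK mulr_algl.
Qed.

(** With the constant function included, these are the functions whose linear
    forms are the polynomials of degree at most 1 in the forms of s. *)
Definition affine_span (s : seq Fun) : {vspace Fun} := <<rcons s one_fun>>%VS.

Definition lin_gen (s : seq Fun) : subringClosed D := gen (map lin_form s).

Lemma lin_form_span s v : v \in affine_span s -> lin_form v \in lin_gen s.
Proof.
move=> vs; rewrite (coord_span (X := in_tuple (rcons s one_fun)) vs) linear_sum rpred_sum // => i _ /=.
rewrite linearZ /=; apply: gen_scale.
have : (rcons s one_fun)`_i \in rcons s one_fun by rewrite mem_nth.
rewrite mem_rcons inE => /orP[/eqP->|si]; first by rewrite lin_form_one rpred1.
by apply/gen_mem/map_f.
Qed.

Lemma lin_gen_full s x : affine_span s = fullv -> x \in lin_gen s.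
Proof.
move=> full; apply: xi_gen => [c|g]; first exact: gen_scalar.
have -> : xi g = lin_form [ffun h => (h == g)%:R].
  rewrite /lin_form (bigD1 g) //= big1 => [|h /negPf hg].
    by rewrite ffunE eqxx scale1r addr0.
  by rewrite ffunE hg scale0r.
by rewrite lin_form_span // full memvf.
Qed.

(** A linear functional lam that kills the span of 1 and s, with lam(w) = 1, makes
    sense of moving the variable w alone: sending lin_form v to
    lin_form v + lam(v) (X - lin_form w) defines a morphism from D to D[X]. *)
Lemma transc_lin_form s w :
  free (rcons s one_fun) -> w \notin affine_span s -> transc (lin_gen s) (lin_form w).
Proof.
move=> free_s wNs; pose X := in_tuple (w :: rcons s one_fun : seq Fun).
have free_X : free X by rewrite free_cons wNs.
pose lam (v : Fun) : k := coord X ord0 v.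
have lam_w : lam w = 1 by have := coord_free ord0 ord0 free_X; rewrite /= /lam => ->.
have lam_s v : v \in rcons s one_fun -> lam v = 0.
  move=> /(nthP 0)[i si <-]; pose j : 'I_(size (rcons s one_fun)).+1 := lift ord0 (Ordinal si).
  by have := coord_free j ord0 free_X; rewrite /= /lam => ->.
pose delta g : Fun := [ffun h => (h == g)%:R].
have deltaE (v : Fun) : v = \sum_g (v g : k) *: delta g.
  apply/ffunP => h; rewrite sum_ffunE (bigD1 h) //= big1 => [|g /negPf gh].
    by rewrite !ffunE eqxx addr0 [RHS]mulr1.
  by rewrite !ffunE eq_sym gh [LHS]mulr0.
have lamE v : lam v = \sum_g v g * lam (delta g).
  by rewrite {1}(deltaE v) /lam linear_sum; apply: eq_bigr => g _; rewrite linearZ.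
pose u : {poly D} := 'X - (lin_form w)%:P.
pose a g : {poly D} := (xi g)%:P + (lam (delta g))%:A%:P * u.
have sum_a (v : Fun) : \sum_g ((v g : k)%:A)%:P * a g = (lin_form v)%:P + (lam v)%:A%:P * u.
  rewrite /lin_form rmorph_sum lamE scaler_suml rmorph_sum mulr_suml -big_split.
  by apply: eq_bigr => g _; apply: polyC_scaleDl.
pose f : {rmorphism k -> {poly D}} := polyC \o GRing.in_alg D.
have [|theta [thX thc]] := xi_universal f (a := a).
  have := sum_a one_fun; rewrite lam_s ?mem_rcons ?mem_head // scale0r mul0r addr0.
  rewrite lin_form_one polyC1 => <-; apply: eq_bigr => g _.
  by rewrite ffunE scale1r mul1r.
have theta_lin v : theta (lin_form v) = (lin_form v)%:P + (lam v)%:A%:P * u.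
  rewrite -sum_a {1}/lin_form rmorph_sum; apply: eq_bigr => g _ /=.
  by rewrite -[X in theta X]mulr_algl rmorphM thc thX.
have theta_gen s' : {subset s' <= rcons s one_fun} ->
    {in gen (map lin_form s'), forall x, theta x = x%:P}.
  elim: s' => [_ x /scalarsP[c ->]|v s' IH sub x /adjP[q Sq ->]]; first exact: thc.
  have lv : theta (lin_form v) = (lin_form v)%:P.
    by rewrite theta_lin lam_s ?scale0r ?mul0r ?addr0 // sub ?mem_head.
  rewrite horner_coef !rmorph_sum; apply: eq_bigr => i _ /=.
  rewrite !rmorphM !rmorphXn /= lv IH ?(polyOverP Sq) // => y ys.
  by rewrite sub // inE ys orbT.
apply: (transc_of_hom (theta := theta)); last first.
  by rewrite theta_lin lam_w scale1r mul1r /u addrC subrK.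
by apply: theta_gen => v; rewrite mem_rcons inE orbC => ->.
Qed.

Variable p : nat.
Hypothesis charkp : p \in [pchar k].
Hypothesis pG : (p.-group [set: G])%g.

Lemma pcharD : p \in [pchar D].
Proof. exact: (rmorph_pchar (GRing.in_alg D)). Qed.

Definition fixed_fun (N : {set G}) (w : Fun) : Prop := forall n, n \in N -> translate n w = w.

Lemma gen_act (ts : seq D) (S : subringClosed D) h :
  (forall c : k, c%:A \in S) -> {in ts, forall t, act h t \in S} ->
  {in gen ts, forall x, act h x \in S}.
Proof.
move=> Sk; elim: ts => [_ x /scalarsP[c ->]|t ts IH tS x /adjP[q Sq ->]].
  by rewrite act_scalar.
rewrite horner_coef rmorph_sum rpred_sum // => i _ /=.
rewrite rmorphM rmorphXn; apply: rpredM; last by rewrite rpredX ?tS ?mem_head.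
apply: (IH _ _ (polyOverP Sq i)).
by move=> u uts; apply: tS; rewrite inE uts orbT.
Qed.

Lemma gen_fixed (ts : seq D) h :
  {in ts, forall t, act h t = t} -> {in gen ts, forall x, act h x = x}.
Proof.
elim: ts => [_ x /scalarsP[c ->]|t ts IH ft x /adjP[q Sq ->]]; first exact: act_scalar.
rewrite horner_coef rmorph_sum; apply: eq_bigr => i _ /=.
rewrite rmorphM rmorphXn (ft t) ?mem_head //; congr (_ * _).
apply: (IH _ _ (polyOverP Sq i)).
by move=> u uts; apply: ft; rewrite inE uts orbT.
Qed.

(** The situation reached after adjoining the forms of s (the last one at the
    head), when N is the current subgroup of the chain. *)
Definition stage (N : {set G}) (s : seq Fun) : Prop :=
  [/\ free (rcons s one_fun), {in s, forall w, fixed_fun N w},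
      forall h, {in affine_span s, forall w, translate h w \in affine_span s},
      has_trace_one act N (lin_gen s)
    & exists fs, [/\ size fs = size s, indep fs
                   & is_invariant_subring act (gen fs) (lin_gen s)]].

Lemma affine_span_cons w s : affine_span (w :: s) = (<[w]> + affine_span s)%VS.
Proof. by rewrite /affine_span /= span_cons. Qed.

Lemma affine_span_one s : one_fun \in affine_span s.
Proof. by rewrite memv_span // mem_rcons mem_head. Qed.

Lemma affine_span_fixed N s :
  {in s, forall w, fixed_fun N w} -> {in affine_span s, forall w, fixed_fun N w}.
Proof.
move=> fs w ws n Nn; rewrite (coord_span (X := in_tuple (rcons s one_fun)) ws).
rewrite linear_sum; apply: eq_bigr => i _; rewrite linearZ /=; congr (_ *: _).
have : (rcons s one_fun)`_i \in rcons s one_fun by rewrite mem_nth.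
by rewrite mem_rcons inE => /orP[/eqP->|/fs->//]; rewrite translate_one.
Qed.

Lemma lin_gen_stable s :
  (forall h, {in affine_span s, forall w, translate h w \in affine_span s}) ->
  act_stable act (lin_gen s).
Proof.
move=> st h; apply: gen_act => [c|_ /mapP[w ws ->]]; first exact: gen_scalar.
by rewrite act_lin_form lin_form_span // st // memv_span // mem_rcons inE ws orbT.
Qed.

Lemma lin_gen_fixed N s :
  {in s, forall w, fixed_fun N w} -> {in lin_gen s, forall x, fixed_by act N x}.
Proof.
move=> fs x xs n Nn; apply: (gen_fixed _ xs) => _ /mapP[w ws ->].
by rewrite act_lin_form (fs w).
Qed.

Lemma act_lin_form_sub s w h :
  translate h w - w \in affine_span s -> act h (lin_form w) - lin_form w \in lin_gen s.
Proof. by move=> ws; rewrite act_lin_form -raddfB lin_form_span. Qed.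

Lemma stage_cons (N M : {set G}) s w :
  stage N s -> M \subset N -> w \notin affine_span s -> fixed_fun M w ->
  (forall h, translate h w - w \in affine_span s) ->
  has_trace_one act M (lin_gen (w :: s)) ->
  (forall fs, indep fs -> is_invariant_subring act (gen fs) (lin_gen s) ->
     exists2 f, transc (gen fs) f
       & is_invariant_subring act (adj (gen fs) f) (lin_gen (w :: s))) ->
  stage M (w :: s).
Proof.
move=> [fr fs st _ [F [sF iF AF]]] /subsetP sMN wNs fw ws translateM ext; split=> //.
- by rewrite /= free_cons wNs.
- move=> v; rewrite inE => /orP[/eqP->//|vs] n Mn; apply: fs => //; exact: sMN.
- move=> h v; rewrite affine_span_cons => /memv_addP[_ /vlineP[c ->] [u us ->]].
  rewrite linearD linearZ /= -[translate h w](subrK w) scalerDr addrAC addrC.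
  rewrite memv_add ?memvZ ?memv_line //.
  by rewrite memvD ?memvZ ?ws ?st.
have [f trf Af] := ext F iF AF.
by exists (f :: F); split=> //=; rewrite sF.
Qed.

Lemma stage_fixed (N : {group G}) s w :
  stage N s -> w \notin affine_span s -> fixed_fun N w ->
  (forall h, translate h w - w \in affine_span s) -> stage N (w :: s).
Proof.
move=> stNs wNs fw ws; have [fr fs st [T [e [trT eS tre]]] _] := stNs.
apply: (stage_cons stNs) => //; first by exists T, e; split=> //; apply: adj_base.
move=> F iF AF; apply: (invariants_adj_fixed (N := N)) => //.
- exact: lin_gen_stable.
- exact: lin_gen_fixed.
- by exists T, e; split.
- exact: transc_lin_form.
- by move=> n Nn; rewrite act_lin_form fw.
- by move=> h; apply: act_lin_form_sub.
Qed.

Lemma stage_shift (N M : {group G}) c s w :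
  stage N s -> (M <| [set: G])%g -> M \subset N -> c \in N -> (c ^+ p)%g \in M ->
  {in N, forall n, exists2 m, m \in M & exists i, n = (m * c ^+ i)%g} ->
  fixed_fun M w -> translate c w = w + one_fun ->
  (forall h, translate h w - w \in affine_span s) -> stage M (w :: s).
Proof.
move=> stNs nM sMN Nc cpM decN fw cw ws; have [fr fs st tr1N _] := stNs.
have act_c : act c (lin_form w) = lin_form w + 1.
  by rewrite act_lin_form cw raddfD /= lin_form_one.
have fS := lin_gen_fixed fs.
have wNs : w \notin affine_span s.
  apply/negP => /(affine_span_fixed fs)/(_ c Nc); rewrite cw => /eqP.
  rewrite -subr_eq0 addrC addKr => /eqP/ffunP/(_ 1%g).
  by rewrite !ffunE => /eqP; rewrite oner_eq0.
apply: (stage_cons stNs) => //.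
  apply: (has_trace_one_adj_shift act1 actM pcharD fS Nc cpM _ decN act_c tr1N).
  by rewrite (subsetP (normal_norm nM)) ?inE.
move=> F iF AF; apply: (invariants_adj_shift act1 actM pcharD _ fS tr1N AF _ Nc decN) => //.
- exact: lin_gen_stable.
- exact: transc_lin_form.
- by move=> n Mn; rewrite act_lin_form fw.
- by move=> h; apply: act_lin_form_sub.
Qed.
(** The Newton expansion of the powers of an operator minus the identity, with the
    binomial coefficients left inside the power of X - 1. *)
Lemma iter_translate_sub c w n :
  iter n (fun v => translate c v - v) w
    = \sum_(i < n.+1) (('X - 1) ^+ n : {poly k})`_i *: translate (c ^+ i)%g w.
Proof.
elim: n => [|n IH]; first by rewrite big_ord1 expr0 coefC /= scale1r translate1.
rewrite iterS IH linear_sum /=; set q := ('X - 1) ^+ n.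
have qn : q`_n.+1 = 0 by rewrite nth_default // /q -polyC1 size_exp_XsubC.
have -> : \sum_(i < n.+2) (('X - 1) ^+ n.+1 : {poly k})`_i *: translate (c ^+ i)%g w
  = \sum_(i < n.+2) (q * 'X)`_i *: translate (c ^+ i)%g w - \sum_(i < n.+2) q`_i *: translate (c ^+ i)%g w.
  rewrite -sumrB; apply: eq_bigr => i _.
  by rewrite exprSr -/q mulrBr mulr1 coefB scalerBl.
congr (_ - _); last by rewrite [RHS]big_ord_recr /= qn scale0r addr0.
rewrite [RHS]big_ord_recl coefMX scale0r add0r; apply: eq_bigr => i _.
by rewrite linearZ /= -translateM -expgSr coefMX.
Qed.

(** In characteristic p, (X - 1)^p = X^p - 1. *)
Lemma iter_translate_sub_p c w : iter p (fun v => translate c v - v) w = translate (c ^+ p)%g w - w.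
Proof.
have p0 : (0 < p)%N by rewrite prime_gt0 // (pcharf_prime charkp).
have pchar_poly : p \in [pchar {poly k}] by apply: (rmorph_pchar (@polyC k)).
have XsubE : ('X - 1) ^+ p = 'X^p - 1 :> {poly k}.
  rewrite -!(pFrobenius_autE pchar_poly) pFrobenius_autB_comm ?pFrobenius_aut1 //.
  exact: mulrC.
rewrite iter_translate_sub XsubE big_ord_recr /= coefB coefXn eqxx coef1 gtn_eqF // subr0 scale1r.
rewrite addrC; congr (_ + _); rewrite -(prednK p0) big_ord_recl /= big1 => [|i _].
  by rewrite coefB coefXn coef1 /= sub0r addr0 expg0 translate1 scaleN1r.
by rewrite coefB coefXn coef1 /= /bump add1n eqSS ltn_eqF // subrr scale0r.
Qed.

(** Going up a chief series, the vectors of V fixed modulo A by M are preserved by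
    delta = c - 1, and delta^p = c^p - 1 sends them into A.  The last iterate of delta
    outside A is then fixed modulo A by c as well. *)
Lemma exists_fixed_vector (A : {vspace Fun}) (V : Fun -> Prop) :
  (forall h, {in A, forall v, translate h v \in A}) ->
  (forall v w, V v -> V w -> V (v - w)) -> (forall h v, V v -> V (translate h v)) ->
  (exists2 w, V w & w \notin A) ->
  exists w, [/\ V w, w \notin A & forall h, translate h w - w \in A].
Proof.
move=> Atr Vsub Vtr exV.
suff claim : forall N : {group G}, (N <| [set: G])%g ->
    exists w, [/\ V w, w \notin A & {in N, forall n, translate n w - w \in A}].
  have [w [Vw wA wN]] := claim [set: G]%G (normal_refl _).
  by exists w; split=> // h; apply: wN; rewrite inE.
move=> N; have [n] := ubnP #|N|; elim: n N => // n IH N Nn nN.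
have [N1|nt] := eqVneq (N : {set G}) 1%g.
  case: exV => w Vw wA; exists w; split=> // h.
  by rewrite N1 => /set1P->; rewrite translate1 subrr mem0v.
have [M [c [_ [[nM pMN Nc cpM] [decN _ _ _ _]]]]] := chief_step charkp pG nN nt.
have [|w0 [Vw0 w0A w0M]] := IH M _ nM.
  exact: leq_trans (proper_card pMN) Nn.
pose delta v : Fun := translate c v - v.
pose P v := V v /\ {in M, forall m, translate m v - v \in A}.
(* moving m past c conjugates it inside the normal subgroup M *)
have Pdelta v : P v -> P (delta v).
  case=> Vv Mv; split; first by apply: Vsub => //; apply: Vtr.
  move=> m Mm; rewrite /delta linearB /= -translateM.
  have -> : (c * m = m ^ c^-1 * c)%g by rewrite conjgE invgK !mulgA mulgKV.
  have Mmc : (m ^ c^-1)%g \in M.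
    by rewrite memJ_norm // (subsetP (normal_norm nM)) ?inE.
  rewrite translateM (_ : _ - _ = translate c (translate (m ^ c^-1) v - v) - (translate m v - v)).
    by rewrite memvB ?Atr ?Mv.
  by rewrite [translate c (_ - v)]linearB /= !opprB addrACA [- _ - _]addrC addrACA.
have Piter i : P (iter i delta w0) by elim: i => [|i IHi]; [split | apply: Pdelta].
have ex : exists i, iter i delta w0 \in A.
  by exists p; rewrite iter_translate_sub_p w0M.
case: (ex_minnP ex) => -[|i] /= iA imin; first by rewrite iA in w0A.
have [Vi Mi] := Piter i; exists (iter i delta w0); split=> //.
  by apply/negP => /imin; rewrite ltnn.
set w := iter i delta w0 in iA Mi *.
have mulA g h : translate g w - w \in A -> translate h w - w \in A -> translate (g * h)%g w - w \in A.
  move=> gA hA; rewrite translateM -[X in X - _](subrK (translate h w)) -addrA -linearB memvD //.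
  exact: Atr.
move=> _ /decN[m Mm [j ->]]; apply: (mulA _ _) => //; first exact: Mi.
elim: j => [|j IHj]; first by rewrite expg0 translate1 subrr mem0v.
by rewrite expgSr; apply: mulA.
Qed.

(** As long as some M-invariant function is missing from the span, a missing one
    that is fixed modulo the span can be adjoined. *)
Lemma stage_fill (M : {group G}) s :
  (M <| [set: G])%g -> stage M s ->
  exists2 s', stage M s' & forall w, fixed_fun M w -> w \in affine_span s'.
Proof.
move=> nM; have [n] := ubnP (#|G| - size s); elim: n s => // n IH s sn stMs.
have [all_in|] := pselect (forall w, fixed_fun M w -> w \in affine_span s).
  by exists s.
move=> /existsNP[w /not_implyP[fw /negP ws]].
have [fr fs st _ _] := stMs.
have [||| w' [fw' w's w'h]] := @exists_fixed_vector (affine_span s) (fixed_fun M) st.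
- by move=> u v fu fv m Mm; rewrite linearB /= fu ?fv.
- move=> h v fv m Mm; rewrite -translateM.
  have -> : (h * m = m ^ h^-1 * h)%g by rewrite conjgE invgK !mulgA mulgKV.
  by rewrite translateM fv // memJ_norm // (subsetP (normal_norm nM)) ?inE.
- by exists w.
have stw : stage M (w' :: s) by apply: stage_fixed.
apply: (IH _ _ stw).
have [frw _ _ _ _] := stw.
have : (size (rcons (w' :: s) one_fun) <= #|G|)%N.
  rewrite -(eqP frw) (leq_trans (dimvS (subvf _))) //.
  by rewrite dimvf /dim /= muln1.
rewrite size_rcons /= => sG; rewrite -ltnS; apply: leq_trans sn.
by rewrite ltnS ltn_sub2l // ltnW.
Qed.

Lemma stage_start : stage [set: G]%g [::].
Proof.
split=> //=.
- rewrite seq1_free; apply/eqP => /ffunP/(_ 1%g); rewrite !ffunE => /eqP.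
  by rewrite oner_eq0.
- move=> h w; rewrite /affine_span /= span_seq1 => /vlineP[c ->].
  by rewrite linearZ /= translate_one memvZ ?memv_line.
- exists [:: 1%g], 1; split; rewrite ?rpred1 ?big_seq1 ?act1 //.
  by move=> x fx; rewrite big_seq1 act1.
exists [::]; split=> // x; split=> [|[]//].
by move=> xk; split=> // g _; apply: (@gen_fixed [::]).
Qed.

(** The form that opens the passage from N to M comes from a function l that is
    shifted by chi; its sign makes translation by c, a right multiplication by c^-1 on
    arguments, add 1. *)
Lemma stage_descend (N : {group G}) s :
  (N <| [set: G])%g -> stage N s ->
  (forall w, fixed_fun N w -> w \in affine_span s) ->
  exists s', stage 1%g s' /\ affine_span s' = fullv.
Proof.
have [n] := ubnP #|N|; elim: n N s => // n IH N s Nn nN stNs sN.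
have [N1|nt] := eqVneq (N : {set G}) 1%g.
  exists s; split; first by rewrite -N1.
  apply/eqP; rewrite eqEsubv subvf; apply/subvP => w _; apply: sN => m.
  by rewrite N1 => /set1P->; rewrite translate1.
have [M [c [chi [[nM pMN Nc cpM] [decN chiM chi0 chic chiJ]]]]] := chief_step charkp pG nN nt.
have [l [lN lh]] := coset_character_function nN chiM chiJ.
have sMN := proper_sub pMN.
pose w : Fun := [ffun g => - l g].
have stM : stage M (w :: s).
  apply: (stage_shift stNs nM sMN Nc cpM decN).
  - move=> m Mm; apply/ffunP => g; rewrite !ffunE lN ?groupV ?(subsetP sMN) //.
    by rewrite chi0 ?groupV // addr0.
  - apply/ffunP => g; rewrite !ffunE lN ?groupV //.
    have : chi (c * c^-1)%g = 0 by rewrite mulgV chi0.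
    rewrite chiM ?groupV // chic => /eqP; rewrite addrC addr_eq0 => /eqP->.
    by rewrite opprD opprK.
  move=> h; apply: sN => m Nm; apply/ffunP => g; rewrite !ffunE.
  rewrite -[LHS]opprD -[RHS]opprD.
  by congr (- _); apply: lh; rewrite groupV.
have [s' stMs' sM'] := stage_fill nM stM.
by apply: (IH M s') => //; apply: leq_trans (proper_card pMN) Nn.
Qed.

Lemma exists_full_stage : exists s, stage 1%g s /\ affine_span s = fullv.
Proof.
apply: (@stage_descend [set: G]%G [::]); [exact: normal_refl | exact: stage_start | move=> w fw].
have -> : w = (w 1%g : k) *: one_fun.
  apply/ffunP => g; rewrite -{1}(fw g) ?inE // !ffunE mulgV.
  by rewrite [RHS]mulr1.
by rewrite memvZ // affine_span_one.
Qed.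

Lemma invariants_tower :
  exists fs : seq D, [/\ size fs = #|G|.-1, indep fs &
    forall x, x \in gen fs <-> (forall g, act g x = x)].
Proof.
have [s [[fr _ _ _ [fs [sfs ifs Afs]]] full]] := exists_full_stage.
exists fs; split=> //.
  rewrite sfs -[size s]/(size s).+1.-1 -(size_rcons s one_fun) -(eqP fr).
  by rewrite -/(affine_span s) full dimvf /dim /= muln1.
move=> x; rewrite Afs; split=> [[_ fx] g|fx]; first exact: fx.
by split=> [|g _]; rewrite ?lin_gen_full.
Qed.

End LinearForms.

(** * The dehomogenized regular ring *)

Section RegularRing.
Variables (k : fieldType) (G : finGroupType).
Local Notation D := (Dk k G).

Definition coord_fun (g : G) : D := toDk (X_ k g).

Lemma sum_coord_fun : \sum_g coord_fun g = 1.
Proof.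
rewrite /coord_fun -rmorph_sum -(rmorph1 (@toDk k G)).
by apply/toDk_eq; exists 1; rewrite mul1r addrC.
Qed.

(** The universal property of D: a morphism out of it is a choice of images of the
    X_g that sum to 1. *)
Lemma Dk_hom (B : comNzRingType) (f : {rmorphism k -> B}) (a : G -> B) :
  \sum_g a g = 1 ->
  exists theta : {rmorphism D -> B},
    (forall g, theta (coord_fun g) = a g) /\ (forall c : k, theta c%:A = f c).
Proof.
move=> a1; pose ev : {rmorphism {mpoly k[#|G|]} -> B} := mmap f (a \o enum_val).
have evX g : ev (X_ k g) = a g by rewrite /ev /= mmapX mmap1U /= enum_rankK.
have ev_alpha : ev (alpha k G) = 0.
  rewrite rmorphD rmorphN rmorph1 rmorph_sum /= (eq_bigr a) => [|g _]; last exact: evX.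
  by rewrite a1 addNr.
pose th (x : D) : B := ev (repr x).
have thE q : th (toDk q) = ev q.
  have [r e] := (toDk_eq (repr (toDk q)) q).1 (toDk_repr _).
  by apply/eqP; rewrite /th -subr_eq0 -rmorphB e rmorphM ev_alpha mulr0.
have zth : zmod_morphism th.
  by move=> x y; rewrite -[x]toDk_repr -[y]toDk_repr -rmorphB !thE rmorphB.
have mth : monoid_morphism th.
  split=> [|x y]; first by rewrite -(rmorph1 (@toDk k G)) thE rmorph1.
  by rewrite -[x]toDk_repr -[y]toDk_repr -rmorphM !thE rmorphM.
pose th1 : {additive D -> B} := HB.pack th (GRing.isZmodMorphism.Build _ _ th zth).
pose th2 : {rmorphism D -> B} := HB.pack th th1 (GRing.isMonoidMorphism.Build _ _ th mth).
exists th2; split=> [g|c] /=.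
  by rewrite thE.
by rewrite -(rmorph1 (@toDk k G)) -linearZ thE /= mmapZ rmorph1 mulr1.
Qed.

Lemma coord_fun_gen (S : subringClosed D) :
  (forall c : k, c%:A \in S) -> (forall g, coord_fun g \in S) -> forall x, x \in S.
Proof.
move=> Sk Sg x; rewrite -[x]toDk_repr (mpolyE (repr x)) rmorph_sum rpred_sum // => m _ /=.
rewrite linearZ /= -mulr_algl rpredM // mpolyXE_id rmorph_prod rpred_prod // => i _ /=.
by rewrite rmorphXn rpredX //=; have := Sg (enum_val i); rewrite /coord_fun /X_ enum_valK.
Qed.

Lemma DkG_mpoly (fs : seq D) :
  indep fs -> (forall x, x \in gen fs <-> (forall g, Dact g x = x)) ->
  exists f : {lrmorphism {mpoly k[size fs]} -> DkG k G}, bijective f.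
Proof.
move=> ifs fsE; pose n := size fs.
have fix_at q : tower_at (ts := fs) q \in Dfixed (k := k) (G := G).
  by apply/DfixedP; apply/fsE/tower_atP; exists q.
pose v (i : 'I_n) : DkG k G := MkDkG (fix_at 'X_i).
pose f : {lrmorphism {mpoly k[n]} -> DkG k G} := mpoly_at v.
pose valD : DkG k G -> D := \val.
pose valDkG : {lrmorphism DkG k G -> D} :=
  HB.pack valD (valD : {rmorphism DkG k G -> D}) (valD : {linear DkG k G -> D}).
have fE q : val (f q) = tower_at (ts := fs) q.
  transitivity (mpoly_at (valDkG \o v) q); first exact: (mpoly_at_comp valDkG).
  apply: mpoly_at_ext => i /=.
  exact: mpoly_atX.
exists f; have /choice[g gE] : forall y : DkG k G, exists q, tower_at (ts := fs) q = val y.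
  move=> y; have /fsE/tower_atP[q ->] : forall g, Dact g (val y) = val y.
    by apply/DfixedP; case: y.
  by exists q.
exists g => [q|y]; last by apply: val_inj; rewrite fE gE.
by apply: (tower_at_inj ifs); rewrite gE fE.
Qed.

End RegularRing.

Theorem theorem1p3 (k : fieldType) (p : nat) (charkp : p \in [pchar k]%R)
    (G : finGroupType) (pG : (p.-group [set: G])%g) :
  is_polynomial_ring (DkG k G) /\ has_krull_dim (DkG k G) (#|G|.-1)%N.
Proof.
have act_xi (g h : G) : Dact h (coord_fun k g) = coord_fun k (g * h)%g.
  by rewrite /coord_fun Dact_toDk symActX.
have act_scalar h (c : k) : Dact h (c%:A : Dk k G) = c%:A.
  by rewrite linearZ /= rmorph1.
have [fs [szfs ifs fsE]] := invariants_tower (act := fun h => Dact h : {rmorphism Dk k G -> Dk k G})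
  (@sum_coord_fun k G) (@Dact1 k G) (@DactM k G) act_scalar act_xi
  (@coord_fun_gen k G) (@Dk_hom k G) charkp pG.
have [f bij_f] := DkG_mpoly ifs fsE.
rewrite -szfs; split; last exact: krull_dim_mpoly bij_f.
by exists (size fs), f.
Qed.
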